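(* Let $S\subset(0,1)$ and $f:S\to[0,1]$. If there exists an algorithm which simulates $f$ on $S$, then for all $n\ge1$ there exist polynomials $$g_n(x,y)=\sum_{k=0}^{n}\binom{n}{k}a(n,k)x^ky^{n-k},\qquad h_n(x,y)=\sum_{k=0}^{n}\binom{n}{k}b(n,k)x^ky^{n-k}$$ with the following properties: (i) $0\le a(n,k)\le b(n,k)\le1$ for all $0\le k\le n$; (ii) $\binom{n}{k}a(n,k)$ and $\binom{n}{k}b(n,k)$ are integers for all $0\le k\le n$; (iii) $\lim_{n}g_n(p,1-p)=f(p)=\lim_{n}h_n(p,1-p)$ for all $p\in S$; (iv) for all $1\le m<n$, $(x+y)^{n-m}g_m(x,y)\preceq g_n(x,y)$ and $h_n(x,y)\preceq(x+y)^{n-m}h_m(x,y)$. Conversely, if there exist such polynomials $g_n(x,y),h_n(x,y)$, $n\ge 1$, satisfying (i)–(iv), then there exists an algorithm which simulates $f$ on $S$ such that the number $N$ of inputs needed satisfies $\mathbf{P}_p(N>n)=h_n(p,1-p)-g_n(p,1-p)$ for all $p\in S$ and $n\ge1$.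
   Context: For homogeneous polynomials $q(x,y),r(x,y)$ of equal degree with real coefficients, $q\preceq r$ means that all coefficients of $r-q$ are nonnegative. For $p\in[0,1]$ let $\mathbf{P}_p$ be the law of an infinite sequence $X_1,X_2,\ldots$ of i.i.d. $\{0,1\}$-valued random variables (''$p$-coin tosses'') with $\mathbf{P}_p(X_i=1)=p$. An algorithm consists of a stopping time $N$ (values in $\{0,1,2,\ldots\}\cup\{\infty\}$) with respect to the natural filtration of $(X_i)_{i\ge1}$, and a $\{0,1\}$-valued output which, on $\{N<\infty\}$, is a function of $(X_1,\ldots,X_N)$ only; no randomness other than the tosses is used, and the algorithm does not depend on $p$. $N$ is the number of inputs needed. The algorithm simulates a function $f:S\to[0,1]$ on $S\subset[0,1]$ if for every $p\in S$ we have $\mathbf{P}_p(N<\infty)=1$ and $\mathbf{P}_p(\text{output}=1)=f(p)$. *)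

(* Defs.v *)
From HB Require Import structures.
From mathcomp Require Import all_boot all_order all_algebra.
From mathcomp Require Import all_classical all_reals all_analysis.
From mathcomp Require Import measurable_realfun ring lra.

Set Implicit Arguments.
Unset Strict Implicit.
Unset Printing Implicit Defensive.
Import Order.TTheory GRing.Theory Num.Theory.
Import numFieldNormedType.Exports.

Local Open Scope classical_set_scope.
Local Open Scope ring_scope.

Definition tosses_gen : set (set (nat -> bool)) :=
  \bigcup_i preimage_set_system setT (fun w : nat -> bool => w i) measurable.

Definition tosses : Type := g_sigma_algebraType tosses_gen.
HB.instance Definition _ := Measurable.on tosses.

(* Indices start at 0: toss i is the variable usually written X_(i+1). *)
Definition toss (i : nat) (w : tosses) : bool := w i.

(* The tosses being boolean, the first clause gives their common law and the
   second one is mutual independence of the whole sequence. *)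
Definition iid_coins (R : realType) (p : R) (P : probability tosses R) :=
  (forall i, P [set w | toss i w] = p%:E) /\
  (forall (J : seq nat) (B : nat -> set bool), uniq J ->
     P (\bigcap_(i in [set` J]) toss i @^-1` B i) =
     (\prod_(i <- J) P (toss i @^-1` B i))%E).

Lemma measurable_toss i (B : set bool) :
  measurable (toss i @^-1` B).
Proof.
apply: sub_sigma_algebra; exists i => //; exists B => //; by rewrite setTI.
Qed.

Lemma measurable_box (J : seq nat) (B : nat -> set bool) :
  measurable (\bigcap_(i in [set` J]) toss i @^-1` B i).
Proof.
by apply: bigcap_measurableType => // i _; exact: measurable_toss.
Qed.

Section coin_law_existence.
Context (R : realType) (p : R).

Let coinp (b : bool) : R := if b then p else 1 - p.
Let probB (B : set bool) : R :=
  (if true \in B then p else 0) + (if false \in B then 1 - p else 0).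

Section iid_marginal.
Variables (P : probability tosses R) (iidP : iid_coins p P).

Lemma iid_coins_marginal i B : P (toss i @^-1` B) = (probB B)%:E.
Proof.
have pt : P (toss i @^-1` [set true]) = p%:E.
  by rewrite -(iidP.1 i); congr (P _); apply/seteqP; split.
have pf : P (toss i @^-1` [set false]) = (1 - p)%:E.
  have -> : toss i @^-1` [set false] = ~` (toss i @^-1` [set true]).
    by apply/seteqP; split => w /=; case: (toss i w).
  by rewrite probability_setC ?pt//; exact: measurable_toss.
rewrite /probB; case: ifPn; case: ifPn; rewrite ?inE ?notin_setE => Bf Bt.
- have -> : B = setT by apply/seteqP; split => // -[].
  by rewrite preimage_setT probability_setT; congr EFin; ring.
- have -> : B = [set true] by apply/seteqP; split => -[].
  by rewrite pt addr0.
- have -> : B = [set false] by apply/seteqP; split => -[].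
  by rewrite pf add0r.
- have -> : B = set0 by apply/seteqP; split => // -[].
  by rewrite preimage_set0 measure0 addr0.
Qed.

End iid_marginal.

Lemma iid_coins_unique (P Q : probability tosses R) :
  iid_coins p P -> iid_coins p Q ->
  forall A, measurable A -> P A = Q A.
Proof.
move=> iP iQ.
pose G : set (set tosses) := [set A | exists (J : seq nat) (B : nat -> set bool),
  uniq J /\ A = \bigcap_(i in [set` J]) toss i @^-1` B i].
have Gm : G `<=` measurable.
  by move=> _ [J [B [_ ->]]]; exact: measurable_box.
have GT : G setT.
  by exists [::], (fun=> setT); split=> //; apply/seteqP; split.
have GI : setI_closed G.
  move=> _ _ [J [B [uJ ->]]] [K [C [uK ->]]].
  exists (undup (J ++ K)), (fun i =>
    (if i \in J then B i else setT) `&` (if i \in K then C i else setT)).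
  split; first exact: undup_uniq.
  apply/seteqP; split => [w [wJ wK] i /= _|w wJK].
    split; case: ifPn => // iJ; [exact: wJ|exact: wK].
  split => i /= iJ; have := wJK i; rewrite /= mem_undup mem_cat iJ ?orbT => /(_ isT)/=.
    by case.
  by case.
move=> A mA.
apply: (@g_sigma_algebra_measure_unique _ _ _ G Gm (fun=> setT)) => //.
- by apply/seteqP; split => // w _; exists 0%N.
- move=> _ [J [B [uJ ->]]]; apply: (etrans (iP.2 J B uJ)).
  apply: (etrans _ (esym (iQ.2 J B uJ))).
  by apply: eq_bigr => i _; rewrite (iid_coins_marginal iP) (iid_coins_marginal iQ).
- by move=> _ /=; rewrite probability_setT ltry.
have : <<s tosses_gen >> A by [].
apply: sub_sigma_algebra2 => _ [i _ [B _ <-]].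
exists [:: i], (fun=> B); split=> //.
apply/seteqP; split => [w /= [_ Bw] j /=|w /= /(_ i)].
  by rewrite inE => /eqP ->.
by rewrite /= inE eqxx => /(_ isT).
Qed.

(* Successive subdivision of [0, 1[ in ratio p : 1 - p, following the half
   containing u; interval i is (left end, length). *)
Let split01 (b : bool) (I : R * R) : R * R :=
  if b then (I.1, p * I.2) else (I.1 + p * I.2, (1 - p) * I.2).
Let bit (u : R) (I : R * R) := u < I.1 + p * I.2.
Let node (u : R) := fix node (n : nat) : R * R :=
  if n is m.+1 then split01 (bit u (node m)) (node m) else (0, 1).
Let ival (w : nat -> bool) := fix ival (n : nat) : R * R :=
  if n is m.+1 then split01 (w m) (ival m) else (0, 1).
Let code (u : R) : tosses := fun n => bit u (node u n).

Let measurable_node n : measurable_fun setT (fun u => (node u n).1) /\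
  measurable_fun setT (fun u => (node u n).2).
Proof.
elim: n => [|n [m1 m2]] /=; first by split; exact: measurable_cst.
have mb : measurable_fun setT (fun u => bit u (node u n)).
  apply: measurable_fun_ltr => //; apply: measurable_funD => //.
  exact: measurable_funM.
split.
  rewrite (_ : (fun _ => _) = (fun u => if bit u (node u n) then (node u n).1
     else (node u n).1 + p * (node u n).2)); last first.
    by apply/funext => u; rewrite /split01; case: ifP.
  apply: measurable_fun_ifT => //; apply: measurable_funD => //.
  exact: measurable_funM.
rewrite (_ : (fun _ => _) = (fun u => if bit u (node u n) then p * (node u n).2
   else (1 - p) * (node u n).2)); last first.
  by apply/funext => u; rewrite /split01; case: ifP.
by apply: measurable_fun_ifT => //; exact: measurable_funM.
Qed.

Let measurable_code : measurable_fun setT code.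
Proof.
apply: (@measurability _ _ _ tosses setT code tosses_gen erefl).
move=> _ [_ [i _ [B _ <-]] <-]; rewrite setTI.
have [m1 m2] := measurable_node i.
have mb : measurable_fun setT (fun u => code u i).
  apply: measurable_fun_ltr => //; apply: measurable_funD => //.
  exact: measurable_funM.
by rewrite setTI; have := mb measurableT B I; rewrite setTI.
Qed.

Hypothesis p01 : 0 <= p <= 1.

Let ival_ge0 w n : 0 <= (ival w n).2.
Proof.
move: p01 => /andP[p0 p1].
elim: n => //= n ih; rewrite /split01; case: (w n) => /=; apply: mulr_ge0 => //.
by rewrite subr_ge0.
Qed.

Let code_ival u w n : 0 <= u < 1 -> (forall i, (i < n)%N -> code u i = w i) <->
  (ival w n).1 <= u < (ival w n).1 + (ival w n).2.
Proof.
move=> u01; have nodeE m : (forall i, (i < m)%N -> code u i = w i) ->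
    node u m = ival w m.
  elim: m => //= m ih uw; rewrite -ih => [|i im]; last by apply: uw; rewrite ltnW.
  by rewrite -(uw m)// /code.
have key m : (forall i, (i < m.+1)%N -> code u i = w i) <->
    (forall i, (i < m)%N -> code u i = w i) /\ code u m = w m.
  split=> [uw|[uw um] i]; first by split=> [i im|]; apply: uw; rewrite // ltnW.
  by rewrite ltnS leq_eqVlt => /predU1P[->//|]; exact: uw.
elim: n => [|n ih]; first by split=> // _ /=; rewrite add0r.
rewrite key; have := ival_ge0 w n; move: p01 => /andP[p0 p1] l0.
have pl : 0 <= p * (ival w n).2 by exact: mulr_ge0.
have ql : 0 <= (1 - p) * (ival w n).2 by apply: mulr_ge0; rewrite // subr_ge0.
rewrite /= /split01; split => [[/[dup] uw /nodeE un <-]|].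
  move/ih : uw => /andP[u1 u2]; rewrite {1 2 3}/code /bit un.
  by case: ltP => uv /=; apply/andP; split; lra.
case wn: (w n) => /= /andP[u1 u2].
  have uw : forall i, (i < n)%N -> code u i = w i by apply/ih/andP; split; lra.
  by split=> //; rewrite /code (nodeE _ uw) /bit; apply/idP; lra.
have uw : forall i, (i < n)%N -> code u i = w i by apply/ih/andP; split; lra.
by split=> //; rewrite /code (nodeE _ uw) /bit; apply/negbTE; rewrite -leNgt; lra.
Qed.

Let m01 : measurable (`[0, 1[%classic : set R). Proof. exact: measurable_itv. Qed.

Let mcode : {mfun measurableTypeR R >-> tosses} := 
  @mfun_Sub _ _ (measurableTypeR R) tosses code (mem_set measurable_code).
Let unif : probability (measurableTypeR R) R :=
  mnormalize (mrestr (@lebesgue_measure R) m01) point.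
Let law : probability tosses R := distribution unif mcode.

Let lawE A : law A = lebesgue_measure ((code @^-1` A) `&` `[0, 1[).
Proof.
have m1 : mrestr (@lebesgue_measure R) m01 setT = 1%E.
  rewrite /mrestr (_ : _ `&` _ = `[0, 1[%classic); last by apply/seteqP; split => // u [].
  by rewrite lebesgue_measure_itv/= lte_fin ltr01 -EFinB subr0.
rewrite /law /distribution /pushforward /unif /= /mnormalize /= !m1 ifF; last first.
  by apply/negbTE; rewrite negb_or !eqe oner_eq0.
by rewrite /= invr1 mule1.
Qed.

Let ival_sub w n : 0 <= (ival w n).1 /\ (ival w n).1 + (ival w n).2 <= 1.
Proof.
elim: n => [|n [l0 l1]] /=; first by rewrite add0r.
have := ival_ge0 w n; move: p01 => /andP[p0 p1] s0.
have pl : 0 <= p * (ival w n).2 by exact: mulr_ge0.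
have ql : 0 <= (1 - p) * (ival w n).2 by apply: mulr_ge0; rewrite // subr_ge0.
by rewrite /split01; case: (w n) => /=; split; lra.
Qed.

Let law_cyl w n : law [set v | forall i, (i < n)%N -> v i = w i] = (ival w n).2%:E.
Proof.
have [l0 l1] := ival_sub w n; have s0 := ival_ge0 w n.
rewrite lawE [X in lebesgue_measure X](_ : _ =
  `[(ival w n).1, (ival w n).1 + (ival w n).2[%classic); last first.
  apply/seteqP; split => u /=; rewrite !in_itv /=.
    by move=> [uw u01]; exact/(code_ival _ _ u01).
  move=> uI; have u01 : 0 <= u < 1 by move/andP: uI => [? ?]; apply/andP; split; lra.
  by split=> //; exact/(code_ival _ _ u01).
rewrite lebesgue_measure_itv/= lte_fin ltrDl -EFinD.
case: ltP => [_|s0']; first by congr EFin; ring.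
by congr EFin; apply/eqP; rewrite eq_le s0 s0'.
Qed.

Let box w n k (B : nat -> set bool) : set tosses :=
  [set v | (forall i, (i < n)%N -> v i = w i) /\
           (forall i, (n <= i < n + k)%N -> B i (v i))].

Let measurable_box' w n k B : measurable (box w n k B).
Proof.
rewrite (_ : box _ _ _ _ =
    (\bigcap_(i in [set i | (i < n)%N]) toss i @^-1` [set w i]) `&`
    (\bigcap_(i in [set i | (n <= i < n + k)%N]) toss i @^-1` B i)).
  by apply: measurableI; apply: bigcap_measurableType => i _; exact: measurable_toss.
by apply/seteqP; split.
Qed.

Let upd (w : nat -> bool) n b : nat -> bool := fun i => if i == n then b else w i.

Let ival_upd w n b : (ival (upd w n b) n.+1).2 = coinp b * (ival w n).2.
Proof.
have E m : (m <= n)%N -> ival (upd w n b) m = ival w m.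
  by elim: m => //= m ih mn; rewrite ih 1?ltnW// /upd ltn_eqF.
by rewrite /= E// /upd eqxx /split01; case: b {E}.
Qed.

Let boxS w n k B b : box w n k.+1 B `&` (toss n @^-1` [set b]) =
  if b \in B n then box (upd w n b) n.+1 k B else set0.
Proof.
case: ifPn; rewrite ?inE ?notin_setE => Bb.
  apply/seteqP; split => v /=.
    move=> [[vw vB] vn]; split => i.
      rewrite ltnS leq_eqVlt /upd => /predU1P[->|ilt]; first by rewrite eqxx.
      by rewrite ltn_eqF// vw.
    by rewrite addSnnS => /andP[ni ik]; apply: vB; rewrite ik ltnW.
  move=> [vw vB]; have vn : v n = b by rewrite vw// /upd eqxx.
  split=> //; split=> [i ilt|i].
    by rewrite vw ?ltnS 1?ltnW// /upd ltn_eqF.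
  rewrite -addSnnS leq_eqVlt => /andP[/predU1P[<- _|ni ik]]; first by rewrite vn.
  by apply: vB; rewrite ni.
by apply/seteqP; split => v //= [[_ vB] vn]; apply: Bb; rewrite -vn;
  apply: vB; rewrite leqnn addnS ltnS leq_addr.
Qed.

Let law_box k w n B :
  law (box w n k B) = ((ival w n).2 * \prod_(n <= i < n + k) probB (B i))%:E.
Proof.
elim: k w n => [|k ih] w n.
  rewrite addn0 big_geq// mulr1 -law_cyl; congr (law _).
  by apply/seteqP; split => v => [[]//|vw]; split=> // i; rewrite addn0; case: ltngtP.
have -> : box w n k.+1 B = (box w n k.+1 B `&` (toss n @^-1` [set true])) `|`
    (box w n k.+1 B `&` (toss n @^-1` [set false])).
  rewrite -setIUr (_ : _ `|` _ = setT) ?setIT//.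
  by apply/seteqP; split => // v _ /=; case: (toss n v); [left|right].
rewrite measureU; last 3 first.
- by apply: measurableI; [exact: measurable_box'|exact: measurable_toss].
- by apply: measurableI; [exact: measurable_box'|exact: measurable_toss].
- by apply/seteqP; split => // v [[_ /= ->]] [].
have -> : \prod_(n <= i < n + k.+1) probB (B i) =
    probB (B n) * \prod_(n.+1 <= i < n.+1 + k) probB (B i).
  by rewrite addSnnS big_ltn// addnS ltnS leq_addr.
rewrite !boxS.
have lawb b : law (if b \in B n then box (upd w n b) n.+1 k B else set0) =
   ((if b \in B n then coinp b else 0) * (ival w n).2 *
    \prod_(n.+1 <= i < n.+1 + k) probB (B i))%:E.
  by case: ifPn => _; [rewrite ih ival_upd|rewrite measure0 !mul0r].
apply: (etrans (congr2 adde (lawb true) (lawb false))).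
rewrite [probB (B n)]/probB /coinp.
move: (\prod_(n.+1 <= i < n.+1 + k) probB (B i)) (ival w n).2 => q s.
by rewrite /adde /=; congr EFin; case: ifP => _; case: ifP => _; ring.
Qed.

Lemma iid_coins_ex : exists P : probability tosses R, iid_coins p P.
Proof.
exists law.
have lawn n (B : nat -> set bool) :
    law [set v | forall i, (i < n)%N -> B i (v i)] =
    (\prod_(0 <= i < n) probB (B i))%:E.
  have := law_box n (fun=> true) 0%N B; rewrite add0n mul1r => <-.
  by congr (law _); apply/seteqP; split => v; [move=> vB; split|case].
have lawi i B : law (toss i @^-1` B) = (probB B)%:E.
  have := lawn i.+1 (fun j => if j == i then B else setT).
  rewrite big_nat_recr//= eqxx big1_seq ?mul1r => [<-|j]; last first.
    rewrite mem_index_iota => /andP[_ /andP[_ ji]].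
    by rewrite ltn_eqF// /probB !in_setT addrC subrK.
  congr (law _); apply/seteqP; split => v /= => [Bv j _|/(_ i (ltnSn _))].
    by case: eqP => [->|].
  by rewrite eqxx.
split=> [i|J B uJ].
  rewrite (_ : [set w | _] = toss i @^-1` [set true]) ?lawi; last by apply/seteqP; split.
  by rewrite /probB mem_set// memNset// addr0.
have [n Jn] : exists n, forall i, i \in J -> (i < n)%N.
  by exists (\max_(i <- J) i).+1 => i iJ; rewrite ltnS; exact: leq_bigmax_seq.
have -> : \bigcap_(i in [set` J]) toss i @^-1` B i =
    [set v | forall i, (i < n)%N -> (if i \in J then B i else setT) (v i)].
  apply/seteqP; split => v /= => [vB i _|vB i iJ].
    by case: ifPn => // /vB.
  by have := vB i (Jn i iJ); rewrite iJ.
rewrite (lawn n (fun i => if i \in J then B i else setT)).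
transitivity (\prod_(i <- J) probB (B i))%:E; last first.
  rewrite (big_morph EFin (@EFinM R) erefl).
  by apply: eq_bigr => i _; rewrite lawi.
congr EFin.
rewrite (bigID (mem J)) /= [X in _ * X]big1 ?mulr1; last first.
  by move=> i /negbTE ->; rewrite /probB !in_setT addrC subrK.
rewrite -big_filter (perm_big J) /=.
  by apply: eq_big_seq => i ->.
apply: uniq_perm => [|//|i]; first exact/seq.filter_uniq/iota_uniq.
rewrite mem_filter mem_index_iota.
by case: (boolP (i \in J)) => // /Jn ->.
Qed.

End coin_law_existence.

(* The law exists and is unique for 0 <= p <= 1 (coin_lawP and
   iid_coins_unique); other values of p give a junk value. *)
Definition coin_law (R : realType) (p : R) : probability tosses R :=
  xget point (iid_coins p).

Lemma coin_lawP (R : realType) (p : R) :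
  0 <= p <= 1 -> iid_coins p (coin_law p).
Proof. by move=> p01; apply: xgetPex; exact: iid_coins_ex. Qed.

Definition natural_filtration (n : nat) : set (set tosses) :=
  g_sigma_preimage (fun i : 'I_n => toss i).

(* None stands for the value oo of the stopping time.  The output is
   rule applied to the tosses that have been read, and there is none on the
   event N = oo. *)
Record algorithm := Algorithm {
  inputs : tosses -> option nat;
  inputs_stopping : forall n,
    natural_filtration n [set w | exists2 m, inputs w = Some m & (m <= n)%N];
  rule : seq bool -> bool
}.

Definition output (A : algorithm) (w : tosses) : option bool :=
  if inputs A w is Some n then Some (rule A (mkseq (toss ^~ w) n)) else None.

Definition inputs_gt (A : algorithm) (n : nat) : set tosses :=
  [set w | if inputs A w is Some m then (n < m)%N else true].

Definition simulates (R : realType) (A : algorithm) (S : set R) (f : R -> R) :=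
  forall p, S p ->
    coin_law p [set w | inputs A w != None] = 1%E /\
    coin_law p [set w | output A w = Some true] = (f p)%:E.

(* As in u.[x, y], 'X is the first variable x and 'Y the second one y. *)
Definition bern (R : realType) (n : nat) (c : nat -> R) : {poly {poly R}} :=
  \sum_(k < n.+1) ('C(n, k)%:R * c k)%:P%:P * 'X ^+ k * 'Y ^+ (n - k).

(* Intended for homogeneous polynomials of equal degree. *)
Definition coef_le (R : realType) (q r : {poly {poly R}}) :=
  forall i j, 0 <= (r - q)`_i`_j.

Record envelopes (R : realType) (S : set R) (f : R -> R)
    (a b : nat -> nat -> R) : Prop := {
  env_bounds : forall n k, (1 <= n)%N -> (k <= n)%N ->
    [/\ 0 <= a n k, a n k <= b n k & b n k <= 1];
  env_int : forall n k, (1 <= n)%N -> (k <= n)%N ->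
    'C(n, k)%:R * a n k \is a Num.int /\ 'C(n, k)%:R * b n k \is a Num.int;
  env_cvg : forall p, S p ->
    (bern n (a n)).[p, 1 - p] @[n --> \oo] --> f p /\
    (bern n (b n)).[p, 1 - p] @[n --> \oo] --> f p;
  env_mono : forall m n, (1 <= m)%N -> (m < n)%N ->
    coef_le (('X + 'Y) ^+ (n - m) * bern m (a m)) (bern n (a n)) /\
    coef_le (bern n (b n)) (('X + 'Y) ^+ (n - m) * bern m (b m))
}.

(* Main.v *)
Require Import Defs.
From mathcomp Require Import all_boot all_order all_algebra.
From mathcomp Require Import all_classical all_reals all_analysis.
From mathcomp Require Import zify ring lra.
Import Order.TTheory GRing.Theory Num.Theory.
Import numFieldNormedType.Exports.

(** The link between algorithms and envelopes is a labelling of finite toss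
    strings: a string is labelled [Some b] when an algorithm that has read it
    has already stopped with output [b], and [None] when it needs more tosses.
    Labels persist under extension of the string ([growing]).  Since all
    strings of length n with k ones have the same probability
    p^k (1-p)^(n-k), the only data that matter for the law of the output are
    the numbers of labelled strings in each class (n, k).  The coefficients
    C(n,k) a(n,k) and C(n,k) (1 - b(n,k)) are exactly the numbers of strings
    labelled 1 and labelled 0 ([encodes]).  Under this dictionary, the bounds
    and the integrality condition say that the coefficients are cardinals of
    disjoint sets of strings; g_n(p,1-p) and 1 - h_n(p,1-p) are the
    probabilities of having output 1, resp. 0, within n tosses; and the limit
    condition says that these two increasing sequences tend to f(p) and
    1 - f(p), so that the algorithm stops almost surely and outputs 1 with
    probability f(p).

    Multiplication by x + y acts on coefficients by Pascal's rule
    u(k) + u(k-1), which also counts the one-toss extensions of a family of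
    strings.  So for n = m + 1 the coefficientwise inequalities say that the
    strings labelled at length m have no more extensions in a class than there
    are strings to be labelled at length m + 1, and the general case follows by
    iteration.

    From an algorithm to envelopes, count the strings labelled by the algorithm
    ([label], [envelopes_labelling]); the stopping time condition is what makes
    the label a function of the string.  From envelopes to an algorithm, build
    the labelling length by length ([labelling_exists]): persistence forces
    some labels, the counting inequalities leave enough room to reach the
    prescribed cardinals, and which further strings are chosen in a class is
    irrelevant.  The algorithm stops at the first labelled prefix
    ([algorithm_of]). *)

Set Implicit Arguments.
Unset Strict Implicit.
Unset Printing Implicit Defensive.

Local Open Scope classical_set_scope.
Local Open Scope ring_scope.

(** * Strings counted by length and number of ones *)

(** Strings are read with the most recent toss at the head, so that adding a
    toss is [cons] and dropping it is [behead]. *)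
Fixpoint strings (n : nat) : seq (seq bool) :=
  if n is m.+1 then map (cons true) (strings m) ++ map (cons false) (strings m)
  else [:: [::]].

Lemma mem_strings n s : (s \in strings n) = (size s == n).
Proof.
have consE c c' t (r : seq (seq bool)) :
    (c :: t \in map (cons c') r) = (c == c') && (t \in r).
  elim: r => [|x r ih]; rewrite ?andbF//= !inE ih eqseq_cons.
  by case: (c == c').
elim: n s => [|n ih] [|c s]; rewrite //= mem_cat ?consE ?ih ?eqSS.
  by apply/negbTE; rewrite negb_or; apply/andP; split; apply/mapP => -[].
by case: c; rewrite ?orbF ?orFb.
Qed.

Lemma strings_uniq n : uniq (strings n).
Proof.
elim: n => //= n ih; rewrite cat_uniq !map_inj_uniq ?ih; try by move=> ? ? [].
by rewrite andbT; apply/hasPn => _ /mapP[s _ ->]; apply/mapP => -[].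
Qed.

Definition nstrings (Q : pred (seq bool)) (n k : nat) : nat :=
  count (fun s => Q s && (count id s == k)) (strings n).

Lemma eq_nstrings (Q Q' : pred (seq bool)) n k :
  (forall s, size s = n -> Q s = Q' s) -> nstrings Q n k = nstrings Q' n k.
Proof.
by move=> QQ'; apply: eq_in_count => s; rewrite mem_strings => /eqP /QQ' ->.
Qed.

Lemma nstringsS Q n k : nstrings Q n.+1 k =
  ((if k is j.+1 then nstrings (Q \o cons true) n j else 0) +
   nstrings (Q \o cons false) n k)%N.
Proof.
rewrite /nstrings /= count_cat !count_map; congr addn.
case: k => [|k]; last by apply: eq_count => s /=; rewrite add1n eqSS.
by rewrite -[RHS](count_pred0 (strings n)); apply: eq_count => s /=; rewrite andbF.
Qed.

(** Pascal's rule counts the one-toss extensions of the strings of [Q]. *)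
Lemma nstrings_behead Q n k : nstrings (Q \o behead) n.+1 k =
  (nstrings Q n k + (if k is j.+1 then nstrings Q n j else 0))%N.
Proof. by rewrite nstringsS addnC. Qed.

Lemma nstrings_total n k : nstrings predT n k = 'C(n, k).
Proof.
elim: n k => [|n ih] k; first by rewrite /nstrings /= eq_sym addn0; case: k.
by rewrite nstringsS !ih; case: k => [|k]; rewrite ?bin0// binS addnC ih.
Qed.

Lemma nstrings_disjoint (P Q : pred (seq bool)) n k :
  (forall s, P s -> ~~ Q s) ->
  (nstrings P n k + nstrings Q n k = nstrings (predU P Q) n k)%N.
Proof.
move=> PQ; rewrite /nstrings -count_predUI.
rewrite [X in (_ + X)%N](_ : _ = 0%N) ?addn0.
  by apply: eq_count => s /=; rewrite andb_orl.
rewrite -(count_pred0 (strings n)); apply: eq_count => s /=.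
by case: (P s) (PQ s) => // /(_ isT)/negbTE ->; rewrite andbF.
Qed.

(** Add to [P] one element of [Q] at a time; as [r] has no repetition each step
    raises the count by one, so no value is skipped. *)
Lemma count_between (T : eqType) (r : seq T) (P Q : pred T) c :
  uniq r -> subpred P Q -> (count P r <= c <= count Q r)%N ->
  exists E : pred T, [/\ subpred P E, subpred E Q & count E r = c].
Proof.
move=> ur + /andP[/subnKC <-]; move: (c - count P r)%N => d.
elim: d P => [|d ih] P PQ dQ; first by exists P; split; rewrite ?addn0.
have [x xr /andP[Qx Px]] : exists2 x, x \in r & Q x && ~~ P x.
  apply/hasP; apply: contraLR dQ => /hasPn QP.
  rewrite -ltnNge addnS ltnS; apply: leq_trans (leq_addr d _).
  have /eq_in_count -> : {in r, Q =1 predI Q P}.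
    by move=> x /QP /=; case: (Q x) => //=; rewrite negbK.
  by apply: sub_count => x /andP[].
have Pxr : count (predU (pred1 x) P) r = (count P r).+1.
  have := count_predUI (pred1 x) P r; rewrite count_uniq_mem// xr add1n => <-.
  rewrite [X in (_ + X)%N](_ : _ = 0%N) ?addn0//.
  rewrite -(count_pred0 r); apply: eq_count => y /=.
  by case: eqP => // ->; apply/negbTE.
have [y /predU1P[->//|/PQ//]||E [PE EQ cE]] := ih (predU (pred1 x) P).
  by rewrite Pxr addSnnS.
exists E; split=> //; first by move=> y Py; apply: PE; rewrite /= Py orbT.
by rewrite cE Pxr addSnnS.
Qed.

(** The classes of strings with k ones are disjoint for different k, so the
    cardinals can be adjusted independently in each. *)
Lemma nstrings_between (P Q : pred (seq bool)) n (c : nat -> nat) :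
  subpred P Q -> (forall k, nstrings P n k <= c k <= nstrings Q n k)%N ->
  exists E, [/\ subpred P E, subpred E Q & forall k, nstrings E n k = c k].
Proof.
move=> PQ cPQ.
have /choice[E HE] : forall k, exists E : pred (seq bool), [/\
    subpred (fun s => P s && (count id s == k)) E,
    subpred E (fun s => Q s && (count id s == k)) & count E (strings n) = c k].
  move=> k; apply: count_between (cPQ k) => //; first exact: strings_uniq.
  by move=> s /andP[/PQ -> ->].
exists (fun s => E (count id s) s); split=> [s Ps|s Es|k].
- by have [+ _ _] := HE (count id s); apply; rewrite Ps /=.
- by have [_ + _] := HE (count id s) => /(_ s Es)/andP[].
- have [_ EQ <-] := HE k; apply: eq_count => s; apply/idP/idP.
    by move=> /andP[+ /eqP <-].
  by move=> Es; have /andP[_ /eqP ->] := EQ s Es; rewrite Es /=.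
Qed.

(** First enlarge the set of strings labelled 1 inside the complement of those
    labelled 0, then the latter inside the complement of the former; the bound
    by the size of the class guarantees room for the second step. *)
Lemma label_extension n (l : seq bool -> option bool) (u : bool -> nat -> nat) :
  (forall b k, nstrings (fun s => l s == Some b) n k <= u b k)%N ->
  (forall k, u true k + u false k <= 'C(n, k))%N ->
  exists l' : seq bool -> option bool,
    (forall s b, l s = Some b -> l' s = Some b) /\
    forall b k, nstrings (fun s => l' s == Some b) n k = u b k.
Proof.
move=> lu uC.
have nbC (P : pred (seq bool)) k :
    (nstrings P n k + nstrings (predC P) n k = 'C(n, k))%N.
  rewrite nstrings_disjoint => [|s]; last by rewrite /= negbK.
  by rewrite -nstrings_total; apply: eq_nstrings => s _; rewrite /= orbN.
have [|k|T [lT Tl Tu]] := @nstrings_between (fun s => l s == Some true)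
    (fun s => l s != Some false) n (u true).
- by move=> s /eqP ->.
- rewrite lu /= -(leq_add2l (nstrings (fun s => l s == Some false) n k)).
  rewrite [leqRHS](nbC (fun s => l s == Some false)) addnC.
  by apply: leq_trans (uC k); rewrite leq_add2l.
have [|k|F [lF FT Fu]] := @nstrings_between (fun s => l s == Some false)
    (predC T) n (u false).
- by move=> s /= ls; apply/negP => /Tl; rewrite ls.
- by rewrite lu /= -(leq_add2l (nstrings T n k)) nbC Tu.
exists (fun s => if T s then Some true else if F s then Some false else None).
split=> [s [] /eqP ls|[] k]; first by rewrite lT.
- by move/lF: ls => Fs; rewrite Fs (negbTE (FT s Fs)).
- by rewrite -Tu; apply: eq_nstrings => s _; case: (T s) => //; case: (F s).
- rewrite -Fu; apply: eq_nstrings => s _; have /= := FT s.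
  by case: (T s); case: (F s) => // /(_ isT).
Qed.

Definition growing (l : seq bool -> option bool) :=
  forall c s b, l s = Some b -> l (c :: s) = Some b.

(** At each length the labels inherited from the previous one are extended to
    the prescribed cardinals.  The first hypothesis leaves room for two disjoint
    families, the second one for the inherited labels. *)
Lemma labelling_exists (u : bool -> nat -> nat -> nat) :
  (forall n k, u true n k + u false n k <= 'C(n, k))%N ->
  (forall b n k, u b n k + (if k is j.+1 then u b n j else 0) <= u b n.+1 k)%N ->
  exists2 l, growing l &
    forall b n k, nstrings (fun s => l s == Some b) n k = u b n k.
Proof.
move=> uC uS.
have /choice[ext extP] : forall x : nat * (seq bool -> option bool),
    exists l' : seq bool -> option bool,
    (forall b k, nstrings (fun s => x.2 s == Some b) x.1 k <= u b x.1 k)%N ->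
    (forall s b, x.2 s = Some b -> l' s = Some b) /\
    forall b k, nstrings (fun s => l' s == Some b) x.1 k = u b x.1 k.
  move=> [n l] /=.
  have [lu|] := pselect (forall b k,
      nstrings (fun s => l s == Some b) n k <= u b n k)%N.
    by have [l' l'P] := label_extension lu (uC n); exists l'.
  by exists l.
pose lab := fix lab n := if n is m.+1 then ext (n, lab m \o behead)
  else ext (0, fun=> None).
have labP n :
    (forall b k, nstrings (fun s => lab n s == Some b) n k = u b n k) /\
    (forall c s b, lab n s = Some b -> lab n.+1 (c :: s) = Some b).
  suff nbl : forall b k, nstrings (fun s => lab n s == Some b) n k = u b n k.
    split=> // c s b ls; have [b' k|+ _] := extP (n.+1, lab n \o behead).
      rewrite (nstrings_behead (fun s => lab n s == Some b')) nbl.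
      by case: k => [|k]; rewrite ?nbl; exact: uS.
    exact.
  elim: n => [|n ih].
    by have [b k|_] := extP (0, fun=> None); rewrite /nstrings /= ?add0n.
  have [b k|_] // := extP (n.+1, lab n \o behead).
  rewrite (nstrings_behead (fun s => lab n s == Some b)) ih.
  by case: k => [|k]; rewrite ?ih; exact: uS.
exists (fun s => lab (size s) s) => [c s b /(labP (size s)).2//|b n k].
by rewrite -(labP n).1; apply: eq_nstrings => s ->.
Qed.

(** * Toss histories and the natural filtration *)

Fixpoint hist (w : tosses) (n : nat) : seq bool :=
  if n is m.+1 then toss m w :: hist w m else [::].

Lemma size_hist w n : size (hist w n) = n.
Proof. by elim: n => //= n ->. Qed.

Lemma rev_hist w n : rev (hist w n) = mkseq (toss ^~ w) n.
Proof. by elim: n => // n ih; rewrite mkseqS rev_cons ih. Qed.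

Lemma eq_hist w v n :
  (forall i, (i < n)%N -> w i = v i) <-> hist w n = hist v n.
Proof.
elim: n => [|n ih]; first by split.
split=> [wv /=|[wvn /ih wv] i].
  by rewrite /toss wv// (ih.1 _)// => i ilt; apply: wv; rewrite ltnW.
by rewrite ltnS leq_eqVlt => /predU1P[->//|/wv].
Qed.

Lemma hist_widen w v m n : (m <= n)%N ->
  hist w n = hist v n -> hist w m = hist v m.
Proof. by move=> mn /eq_hist wv; apply/eq_hist => i im; apply: wv; lia. Qed.

Definition word (s : seq bool) : tosses := fun i => nth false (rev s) i.

Lemma hist_word s : hist (word s) (size s) = s.
Proof.
apply/(can_inj revK); rewrite rev_hist -(size_rev s).
exact: mkseq_nth.
Qed.

Lemma natural_filtrationE n : natural_filtration n =
  <<s \bigcup_(i in `I_n) preimage_set_system setT (toss i) measurable >>.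
Proof. by rewrite bigcup_mkord. Qed.

(** Sets that do not separate [w] from [v] form a sigma-algebra, and it
    contains the generators of the filtration. *)
Lemma natural_filtration_local n A w v :
  natural_filtration n A -> hist w n = hist v n -> A w -> A v.
Proof.
move=> nA wv; suff : A w <-> A v by case.
move: nA; pose L := [set A : set tosses | A w <-> A v].
suff : natural_filtration n `<=` L by apply.
rewrite natural_filtrationE.
apply: smallest_sub; first split.
- by split.
- by move=> B; rewrite /L /= => BL; split => -[_ nB]; split=> // /BL.
- by move=> F FL; split => -[i _ Fi]; exists i => //; apply/FL.
move=> B [i /= ilt [C _ <-]].
by rewrite /L /= /toss; move/eq_hist : wv => ->.
Qed.

Lemma natural_filtration_measurable n : natural_filtration n `<=` measurable.
Proof.
rewrite natural_filtrationE; apply: smallest_sub; first exact: sigma_algebra_measurable.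
move=> B [i /= ilt [C _ <-]].
by rewrite setTI; exact: measurable_toss.
Qed.

(** Induction on the length [m] of the history while the filtration stays at
    time [n]: split according to toss [m]. *)
Lemma natural_filtration_hist n (Q : pred (seq bool)) :
  natural_filtration n [set w | Q (hist w n)].
Proof.
rewrite natural_filtrationE.
pose F := \bigcup_(i in `I_n) preimage_set_system setT (toss i) measurable.
suff : @measurable _ (g_sigma_algebraType F) [set w | Q (hist w n)] by [].
have : (n <= n)%N by [].
elim: {1 3}n Q => [|m ih] Q mn.
  case q : (Q [::]).
    by rewrite (_ : [set _ | _] = setT)//; apply/seteqP; split.
  by rewrite (_ : [set _ | _] = set0)//; apply/seteqP; split => // w /=; rewrite q.
have mtoss b : @measurable _ (g_sigma_algebraType F) (toss m @^-1` [set b]).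
  apply: sub_sigma_algebra.
  by exists m => //; exists [set b] => //; rewrite setTI.
rewrite (_ : [set _ | _] =
    ([set w | Q (true :: hist w m)] `&` toss m @^-1` [set true]) `|`
    ([set w | Q (false :: hist w m)] `&` toss m @^-1` [set false])).
  apply: measurableU; apply: measurableI => //.
    exact: (ih (Q \o cons true) (ltnW mn)).
  exact: (ih (Q \o cons false) (ltnW mn)).
apply/seteqP; split => w /=.
  by case: (toss m w); [left|right].
by case=> -[+ ->].
Qed.

Lemma measurable_hist n (Q : pred (seq bool)) :
  measurable ([set w | Q (hist w n)] : set tosses).
Proof. exact: natural_filtration_measurable (@natural_filtration_hist n Q). Qed.

(** * The law of the toss history *)

Section coin_law_hist.
Context (R : realType) (p : R) (p01 : 0 <= p <= 1).

Lemma coin_law_word s :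
  coin_law p [set w | hist w (size s) = s] =
  (p ^+ count id s * (1 - p) ^+ (size s - count id s))%:E.
Proof.
have iidP := coin_lawP p01.
rewrite (_ : [set _ | _] = \bigcap_(i in [set` iota 0 (size s)])
    toss i @^-1` [set word s i]); last first.
  apply/seteqP; split => w /= wE.
    move=> i /=; rewrite mem_iota add0n => ilt; move: i ilt; apply/eq_hist.
    by rewrite hist_word.
  by rewrite -[RHS]hist_word; apply/eq_hist => i ilt; apply: wE; rewrite /= mem_iota.
rewrite iidP.2 ?iota_uniq//.
under eq_bigr do rewrite (iid_coins_marginal iidP).
rewrite -(big_morph EFin (@EFinM R) erefl); congr EFin.
rewrite (eq_bigr (fun i => if word s i then p else 1 - p)); last first.
  move=> i _; rewrite (_ : (true \in _) = word s i).
    rewrite (_ : (false \in _) = ~~ word s i).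
      by case: (word s i); rewrite ?addr0 ?add0r.
    by apply/idP/idP; rewrite inE /=; case: (word s i).
  by apply/idP/idP; rewrite inE /=; case: (word s i).
rewrite -(big_map (word s) xpredT (fun b : bool => if b then p else 1 - p)).
rewrite -/(mkseq _ _) -[size s]size_rev mkseq_nth size_rev (perm_big s) ?perm_rev//.
elim: s => [|b s ih]; first by rewrite big_nil mulr1.
rewrite big_cons ih; case: b => /=.
  by rewrite add1n exprS subSS mulrA.
by rewrite add0n subSn ?count_size// exprS; ring.
Qed.

(** The value at (p, 1 - p) of the form of degree [n] with coefficients [u]. *)
Definition eval_form (u : nat -> R) n :=
  \sum_(k < n.+1) u k * p ^+ k * (1 - p) ^+ (n - k).

(** Group the strings of [Q] by their number of ones, on which their probability
    depends. *)
Lemma coin_law_hist n (Q : pred (seq bool)) :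
  coin_law p [set w | Q (hist w n)] =
  (eval_form (fun k => (nstrings Q n k)%:R) n)%:E.
Proof.
pose L := [seq s <- strings n | Q s].
have uL : uniq L by exact/seq.filter_uniq/strings_uniq.
have szL s : s \in L -> size s = n by rewrite mem_filter mem_strings => /andP[_ /eqP].
rewrite (_ : [set _ | _] = [set w | hist w n \in L]); last first.
  by apply/seteqP; split => w /=; rewrite mem_filter mem_strings size_hist eqxx andbT.
transitivity (\sum_(s <- L) p ^+ count id s * (1 - p) ^+ (n - count id s))%:E.
  elim: L uL szL => [_ _|s L ih /= /andP[sL uL] szL].
    by rewrite big_nil (_ : [set _ | _] = set0) ?measure0//; apply/seteqP; split.
  rewrite big_cons (_ : [set _ | _] =
      [set w | hist w n = s] `|` [set w | hist w n \in L]); last first.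
    apply/seteqP; split => w /=; rewrite inE.
      by move=> /predU1P.
    by move=> h; apply/predU1P.
  rewrite measureU; last 3 first.
  - have := measurable_hist n (pred1 s); congr measurable.
    by apply/seteqP; split => w /eqP.
  - exact: (measurable_hist n (mem L)).
  - by apply/seteqP; split => // w [/= ->]; rewrite (negbTE sL).
  rewrite EFinD; congr adde.
    have sn : size s = n by apply: szL; rewrite inE eqxx.
    by have := coin_law_word s; rewrite sn; apply.
  by apply: ih => // t tL; apply: szL; rewrite inE tL orbT.
congr EFin; rewrite /eval_form.
transitivity (\sum_(s <- L) \sum_(k < n.+1)
    if count id s == k then p ^+ k * (1 - p) ^+ (n - k) else 0).
  apply: eq_big_seq => s /szL sn; have kn : (count id s < n.+1)%N.
    by rewrite ltnS -sn count_size.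
  by rewrite -big_mkcond (big_pred1 (Ordinal kn)) // => k; rewrite eq_sym.
rewrite exchange_big /=; apply: eq_bigr => k _.
rewrite -big_mkcond /= big_const_seq iter_addr_0 count_filter.
by rewrite -mulrA mulr_natl; congr (_ *+ _); apply: eq_count => s /=; rewrite andbC.
Qed.

End coin_law_hist.

(** * Bernstein forms and multiplication by x + y *)

(** The action of multiplication by x + y on the coefficients of a form. *)
Definition pascal (R : realType) (u : nat -> R) (k : nat) : R :=
  u k + (if k is j.+1 then u j else 0).

Lemma coef_bern (R : realType) n (c : nat -> R) i j :
  (bern n c)`_i`_j = if (i + j == n)%N then 'C(n, i)%:R * c i else 0.
Proof.
rewrite /bern !coef_sum.
have E (k : 'I_n.+1) : (('C(n, k)%:R * c k)%:P%:P * 'X ^+ k *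
    'X%:P ^+ (n - k) : {poly {poly R}})`_i`_j =
    if (i == k) && (j == n - k)%N then 'C(n, k)%:R * c k else 0.
  rewrite -rmorphXn /= coefMC coefCM coefXn.
  case: eqP => /= _; last by rewrite mulr0 mul0r coef0.
  by rewrite mulr1 coefCM coefXn; case: eqP => _; rewrite ?mulr1 ?mulr0.
rewrite (eq_bigr _ (fun k _ => E k)) -big_mkcond /=.
case: eqP => [ijn|ijn].
  have ilt : (i < n.+1)%N by lia.
  rewrite (big_pred1 (Ordinal ilt))// => k.
  rewrite /= -val_eqE /=; apply/andP/eqP => [[/eqP ? /eqP ?]|?]; first by lia.
  by split; apply/eqP; lia.
by rewrite big1// => k /andP[/eqP ik /eqP jk]; have := ltn_ord k; lia.
Qed.

Lemma coef_XYM (R : realType) (q : {poly {poly R}}) i j :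
  (('X + 'Y) * q)`_i`_j =
  (if i is i'.+1 then q`_i'`_j else 0) + (if j is j'.+1 then q`_i`_j' else 0).
Proof.
rewrite mulrDl !coefD coefXM coefCM coefXM.
by case: i j => [|i] [|j]; rewrite //= coef0.
Qed.

Lemma coef_leP (R : realType) (q r : {poly {poly R}}) :
  coef_le q r <-> forall i j, q`_i`_j <= r`_i`_j.
Proof. by split => h i j; have := h i j; rewrite !coefB subr_ge0. Qed.

Lemma coef_XY_bern (R : realType) n (c : nat -> R) i j :
  (('X + 'Y) * bern n c)`_i`_j =
  if (i + j == n.+1)%N then pascal (fun k => 'C(n, k)%:R * c k) i else 0.
Proof.
rewrite coef_XYM /pascal; case: i j => [|i] [|j]; rewrite ?coef_bern ?add0r.
- by rewrite addr0.
- by rewrite !add0n eqSS addr0.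
- rewrite !addn0 eqSS addr0; case: eqP => // ->.
  by rewrite (@bin_small n n.+1)// mul0r add0r.
- rewrite !addSn !addnS !eqSS -[(i + j).+1]addSn addrC.
  by case: eqP => _; rewrite ?addr0.
Qed.

Lemma XY_bern_le (R : realType) n (c d : nat -> R) :
  coef_le (('X + 'Y) * bern n c) (bern n.+1 d) <->
  forall k, (k <= n.+1)%N ->
    pascal (fun k => 'C(n, k)%:R * c k) k <= 'C(n.+1, k)%:R * d k.
Proof.
rewrite coef_leP; split=> [cd k kn|cd i j].
  by have := cd k (n.+1 - k)%N; rewrite coef_XY_bern coef_bern subnKC// eqxx.
rewrite coef_XY_bern coef_bern; case: eqP => // ij; apply: cd; lia.
Qed.

Lemma bern_le_XY (R : realType) n (c d : nat -> R) :
  coef_le (bern n.+1 d) (('X + 'Y) * bern n c) <->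
  forall k, (k <= n.+1)%N ->
    'C(n.+1, k)%:R * d k <= pascal (fun k => 'C(n, k)%:R * c k) k.
Proof.
rewrite coef_leP; split=> [cd k kn|cd i j].
  by have := cd k (n.+1 - k)%N; rewrite coef_XY_bern coef_bern subnKC// eqxx.
rewrite coef_XY_bern coef_bern; case: eqP => // ij; apply: cd; lia.
Qed.

Lemma coef_le_XYM (R : realType) (q r : {poly {poly R}}) :
  coef_le q r -> coef_le (('X + 'Y) * q) (('X + 'Y) * r).
Proof.
move=> /coef_leP qr; apply/coef_leP => i j; rewrite !coef_XYM.
by apply: lerD; [case: i|case: j].
Qed.

Lemma coef_le_trans (R : realType) (q r s : {poly {poly R}}) :
  coef_le q r -> coef_le r s -> coef_le q s.
Proof.
by move=> /coef_leP qr /coef_leP rs; apply/coef_leP => i j; exact: le_trans (rs i j).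
Qed.

(** Coefficientwise inequalities between consecutive degrees propagate, because
    multiplication by x + y preserves the coefficientwise order. *)
Lemma XYX_le (R : realType) (q : nat -> {poly {poly R}}) m n : (m < n)%N ->
  (forall k, (m <= k < n)%N -> coef_le (('X + 'Y) * q k) (q k.+1)) ->
  coef_le (('X + 'Y) ^+ (n - m) * q m) (q n).
Proof.
elim: n => // n ih; rewrite ltnS leq_eqVlt => /predU1P[-> h|mn h].
  by rewrite subSnn expr1; apply: h; lia.
rewrite subSn 1?ltnW// exprS -mulrA.
apply: coef_le_trans (h n _); last lia.
by apply/coef_le_XYM/ih => // k kn; apply: h; lia.
Qed.

Lemma le_XYX (R : realType) (q : nat -> {poly {poly R}}) m n : (m < n)%N ->
  (forall k, (m <= k < n)%N -> coef_le (q k.+1) (('X + 'Y) * q k)) ->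
  coef_le (q n) (('X + 'Y) ^+ (n - m) * q m).
Proof.
elim: n => // n ih; rewrite ltnS leq_eqVlt => /predU1P[-> h|mn h].
  by rewrite subSnn expr1; apply: h; lia.
rewrite subSn 1?ltnW// exprS -mulrA.
apply: coef_le_trans (h n _) _; first lia.
by apply/coef_le_XYM/ih => // k kn; apply: h; lia.
Qed.

Lemma horner_bern (R : realType) n (c : nat -> R) p :
  (bern n c).[p, 1 - p] = eval_form p (fun k => 'C(n, k)%:R * c k) n.
Proof.
rewrite /bern /eval_form !horner_sum; apply: eq_bigr => k _.
by rewrite !hornerE.
Qed.

(** * Growing labellings *)

(** The event that the algorithm described by [l] outputs [b]. *)
Definition verdict (l : seq bool -> option bool) (b : bool) : set tosses :=
  [set w | exists n, l (hist w n) = Some b].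

Definition nlabelled (l : seq bool -> option bool) (b : bool) (n k : nat) : nat :=
  nstrings (fun s => l s == Some b) n k.

Lemma nlabelled_le l n k :
  (nlabelled l true n k + nlabelled l false n k <= 'C(n, k))%N.
Proof.
rewrite /nlabelled nstrings_disjoint => [|s /eqP ->//]; rewrite -nstrings_total.
by apply: sub_count => s /andP[_ ->].
Qed.

Lemma nstrings_None l n k : (nstrings (fun s => l s == None) n k +
  (nlabelled l true n k + nlabelled l false n k) = 'C(n, k))%N.
Proof.
rewrite [(nlabelled l true n k + _)%N]nstrings_disjoint => [|s /eqP ->//].
rewrite nstrings_disjoint => [|s /eqP /= ->//]; rewrite -nstrings_total.
by apply: eq_nstrings => s _ /=; case: (l s) => [[]|].
Qed.

Section growing.
Variables (l : seq bool -> option bool) (gl : growing l).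

Lemma nlabelled_growing b n k :
  (nlabelled l b n k + (if k is j.+1 then nlabelled l b n j else 0) <=
   nlabelled l b n.+1 k)%N.
Proof.
rewrite -(nstrings_behead (fun s => l s == Some b)); apply: sub_count => -[|c s] //=.
by move=> /andP[/eqP /gl -> ->]; rewrite eqxx.
Qed.

Lemma growing_hist w m n b : (m <= n)%N ->
  l (hist w m) = Some b -> l (hist w n) = Some b.
Proof.
elim: n => [|n ih]; first by rewrite leqn0 => /eqP ->.
by rewrite leq_eqVlt => /predU1P[->//|mn /(ih mn)]; exact: gl.
Qed.

Lemma measurable_verdict b : measurable (verdict l b).
Proof.
rewrite (_ : verdict l b = \bigcup_n [set w | l (hist w n) == Some b]).
  by apply: bigcup_measurable => n _; exact: (measurable_hist n (fun s => l s == Some b)).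
by apply/seteqP; split => w [n]; [move=> /eqP ln; exists n|move=> _ /eqP; exists n].
Qed.

Lemma verdict_disjoint : verdict l true `&` verdict l false = set0.
Proof.
apply/seteqP; split => // w [[m lm] [n ln]].
have := growing_hist (leq_maxr m n) ln.
by rewrite (growing_hist (leq_maxl m n) lm).
Qed.

(** The events of being labelled [b] within [n] tosses increase to the verdict
    [b], so continuity of the measure from below applies. *)
Lemma cvg_verdict (R : realType) (p : R) b : 0 <= p <= 1 ->
  eval_form p (fun k => (nlabelled l b n k)%:R) n @[n --> \oo] -->
  fine (coin_law p (verdict l b)).
Proof.
move=> p01; pose F n := [set w | l (hist w n) == Some b].
have FE : verdict l b = \bigcup_n F n.
  by apply/seteqP; split => w [n]; [move=> /eqP ln; exists n|move=> _ /eqP; exists n].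
have mF n : measurable (F n) by exact: (measurable_hist n (fun s => l s == Some b)).
have cF : (coin_law p \o F) n @[n --> \oo] --> coin_law p (\bigcup_n F n).
  apply: nondecreasing_cvg_mu => //; first by rewrite -FE; exact: measurable_verdict.
  move=> m n mn; apply/subsetPset => w /eqP lm; apply/eqP.
  exact: growing_hist lm.
rewrite (_ : (fun n => _) = fine \o (coin_law p \o F)); last first.
  apply/funext => n /=.
  by have -> := coin_law_hist p01 n (fun s => l s == Some b).
apply: fine_cvg; rewrite fineK ?FE//.
by apply: fin_num_measure; rewrite -FE; exact: measurable_verdict.
Qed.

End growing.

(** * The dictionary between labellings and envelopes *)

Lemma eval_form_bin (R : realType) (p : R) n :
  eval_form p (fun k => 'C(n, k)%:R) n = 1.
Proof.
rewrite -[RHS](expr1n R n) -{2}(subrK p 1) exprDn /eval_form.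
by apply: eq_bigr => k _; rewrite -mulrA mulr_natl mulrC.
Qed.

(** The dictionary between labellings and envelopes at degree [n]: the upper
    coefficients count the strings that are not labelled 0. *)
Definition encodes (R : realType) (l : seq bool -> option bool)
    (a b : nat -> nat -> R) (n : nat) :=
  forall k, (k <= n)%N -> 'C(n, k)%:R * a n k = (nlabelled l true n k)%:R /\
    'C(n, k)%:R * b n k = 'C(n, k)%:R - (nlabelled l false n k)%:R.

Lemma horner_encodes (R : realType) l (a b : nat -> nat -> R) n p :
  encodes l a b n ->
  (bern n (a n)).[p, 1 - p] =
    eval_form p (fun k => (nlabelled l true n k)%:R) n /\
  (bern n (b n)).[p, 1 - p] =
    1 - eval_form p (fun k => (nlabelled l false n k)%:R) n.
Proof.
move=> e; rewrite !horner_bern; split.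
  by apply: eq_bigr => k _; have [->] := e k (leq_ord k).
rewrite -[X in X - _](eval_form_bin p n) -sumrB; apply: eq_bigr => k _.
by have [_ ->] := e k (leq_ord k); rewrite !mulrBl.
Qed.

(** Degree 0 is left out of the envelopes, hence of the dictionary; limits do
    not see it. *)
Lemma cvg_encodes (R : realType) l (a b : nat -> nat -> R) (p ft ff : R) :
  (forall n, (0 < n)%N -> encodes l a b n) ->
  (bern n (a n)).[p, 1 - p] @[n --> \oo] --> ft /\
  (bern n (b n)).[p, 1 - p] @[n --> \oo] --> 1 - ff <->
  eval_form p (fun k => (nlabelled l true n k)%:R) n @[n --> \oo] --> ft /\
  eval_form p (fun k => (nlabelled l false n k)%:R) n @[n --> \oo] --> ff.
Proof.
move=> e.
have npos : \forall n \near \oo, (0 < n)%N by exact: nbhs_infty_gt.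
split=> -[ct cf]; split.
- apply: cvg_trans ct; apply: near_eq_cvg; near=> n.
  by rewrite (horner_encodes p (e n _)).1//; near: n.
- rewrite -[ff](subKr 1).
  have : (1 - (bern n (b n)).[p, 1 - p]) @[n --> \oo] --> 1 - (1 - ff).
    by apply: cvgB cf; exact: cvg_cst.
  apply: cvg_trans; apply: near_eq_cvg; near=> n.
  by rewrite (horner_encodes p (e n _)).2 ?subKr//; near: n.
- apply: cvg_trans ct; apply: near_eq_cvg; near=> n.
  by rewrite (horner_encodes p (e n _)).1//; near: n.
- have : (1 - eval_form p (fun k => (nlabelled l false n k)%:R) n) @[n --> \oo]
      --> 1 - ff by apply: cvgB cf; exact: cvg_cst.
  apply: cvg_trans; apply: near_eq_cvg; near=> n.
  by rewrite (horner_encodes p (e n _)).2//; near: n.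
Unshelve. all: by end_near. Qed.

Lemma pascal_bin (R : realType) n k :
  pascal (fun k => 'C(n, k)%:R : R) k = 'C(n.+1, k)%:R.
Proof. by rewrite /pascal; case: k => [|k]; rewrite ?bin0 ?addr0// binS natrD. Qed.

Lemma eq_pascal (R : realType) (u v : nat -> R) n k : (k <= n.+1)%N ->
  (forall j, (j <= n)%N -> u j = v j) -> u n.+1 = v n.+1 ->
  pascal u k = pascal v k.
Proof.
move=> kn uv uvn; rewrite /pascal; congr (_ + _).
  by move: kn; rewrite leq_eqVlt => /predU1P[->//|]; rewrite ltnS => /uv.
by case: k kn => // k; rewrite ltnS => /uv.
Qed.

Lemma nlabelled_small l b n k : (n < k)%N -> nlabelled l b n k = 0%N.
Proof. by move=> nk; have := nlabelled_le l n k; rewrite bin_small//; case: b; lia. Qed.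

Lemma pascal_encodes (R : realType) l (a b : nat -> nat -> R) n k :
  encodes l a b n -> (k <= n.+1)%N ->
  pascal (fun k => 'C(n, k)%:R * a n k) k =
    (nlabelled l true n k + if k is j.+1 then nlabelled l true n j else 0)%:R /\
  pascal (fun k => 'C(n, k)%:R * b n k) k = 'C(n.+1, k)%:R -
    (nlabelled l false n k + if k is j.+1 then nlabelled l false n j else 0)%:R.
Proof.
move=> e kn; rewrite -pascal_bin; split.
  rewrite (@eq_pascal _ _ (fun k => (nlabelled l true n k)%:R) n) //.
  - by rewrite /pascal natrD; case: (k).
  - by move=> j /e[].
  - by rewrite nlabelled_small// bin_small// mul0r.
rewrite (@eq_pascal _ _ (fun k => 'C(n, k)%:R - (nlabelled l false n k)%:R) n) //.
- by rewrite /pascal natrD; case: (k) => [|j]; ring.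
- by move=> j /e[].
- by rewrite nlabelled_small// bin_small// mul0r subr0.
Qed.

(** Bounds and integrality express that the labelled strings form disjoint
    subsets of each class; monotonicity is persistence of labels. *)
Lemma envelopes_labelling (R : realType) (S : set R) (f : R -> R) l :
  S `<=` `]0, 1[ -> growing l ->
  (forall p, S p -> coin_law p (verdict l true) = (f p)%:E /\
    coin_law p (verdict l false) = (1 - f p)%:E) ->
  envelopes S f (fun n k => (nlabelled l true n k)%:R / 'C(n, k)%:R)
    (fun n k => 1 - (nlabelled l false n k)%:R / 'C(n, k)%:R).
Proof.
move=> S01 gl lf; set a := (X in envelopes S f X _).
set b := (X in envelopes S f a X).
have binR n k : (k <= n)%N -> 0 < 'C(n, k)%:R :> R by rewrite ltr0n bin_gt0.
have e n : encodes l a b n.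
  move=> k /binR/lt0r_neq0 C0; rewrite /a /b.
  by rewrite mulrBr mulr1 ![_ * (_ / _)]mulrC !divfK.
split=> [n k _ kn|n k _ kn|p Sp|m n _ mn].
- have C0 := binR n k kn; have := nlabelled_le l n k; rewrite -(ler_nat R) natrD => le.
  rewrite /a /b; split; first exact: divr_ge0.
    by rewrite lerBrDr -mulrDl ler_pdivrMr// mul1r.
  by rewrite gerBl divr_ge0.
- have [-> ->] := e n k kn; split; first exact: rpred_nat.
  by apply: rpredB; exact: rpred_nat.
- have p01 : 0 <= p <= 1.
    by have := S01 p Sp; rewrite /= in_itv /= => /andP[/ltW -> /ltW ->].
  rewrite -{2}(subKr 1 (f p)); apply/(cvg_encodes p _ _ (fun n _ => e n)).
  have [lt lff] := lf p Sp.
  by split; [have := @cvg_verdict _ gl _ _ true p01; rewrite lt|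
    have := @cvg_verdict _ gl _ _ false p01; rewrite lff].
- split.
    apply: (XYX_le (q := fun n => bern n (a n))) => // k _.
    apply/XY_bern_le => j jk; rewrite (pascal_encodes (e k) jk).1.
    by rewrite (e k.+1 j jk).1 ler_nat nlabelled_growing.
  apply: (le_XYX (q := fun n => bern n (b n))) => // k _.
  apply/bern_le_XY => j jk; rewrite (pascal_encodes (e k) jk).2.
  by rewrite (e k.+1 j jk).2 lerD2l lerN2 ler_nat nlabelled_growing.
Qed.

(** The counts to be realized are read off from the envelopes; the conditions
    of [labelling_exists] are the bounds and the monotonicity for consecutive
    degrees. *)
Lemma labelling_envelopes (R : realType) (S : set R) (f : R -> R) a b :
  envelopes S f a b ->
  exists2 l, growing l & forall n, (0 < n)%N -> encodes l a b n.
Proof.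
move=> env.
(* Starting with no label on the empty string makes persistence from length 0
   to length 1 vacuous. *)
pose u (c : bool) n k := if n is 0 then 0%N else
  Num.truncn (if c then 'C(n, k)%:R * a n k else 'C(n, k)%:R * (1 - b n k)).
have uE n k : (0 < n)%N -> 'C(n, k)%:R * a n k = (u true n k)%:R /\
    'C(n, k)%:R * b n k = 'C(n, k)%:R - (u false n k)%:R.
  case: n => // n _; have [kn|kn] := leqP k n.+1; last first.
    by rewrite /u bin_small// !mul0r truncn0 subrr.
  have [a0 ab b1] := env_bounds env (ltn0Sn n) kn.
  have [ai bi] := env_int env (ltn0Sn n) kn.
  rewrite /u /= !truncnK; first by split=> //; ring.
    rewrite natrEint mulr_ge0 ?subr_ge0// andbT mulrBr mulr1.
    by rewrite rpredB ?rpred_nat.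
  by rewrite natrEint ai mulr_ge0.
have uC n k : (u true n k + u false n k <= 'C(n, k))%N.
  case: n => // n; have [kn|kn] := leqP k n.+1; last first.
    by rewrite /u bin_small// !mul0r truncn0.
  have [a0 ab b1] := env_bounds env (ltn0Sn n) kn.
  have [ta tb] := uE n.+1 k isT.
  rewrite -(ler_nat R) natrD -ta.
  have := ler_wpM2l (ler0n R 'C(n.+1, k)) ab; lra.
have uS c n k : (u c n k + (if k is j.+1 then u c n j else 0) <= u c n.+1 k)%N.
  case: n => [|n]; first by case: k.
  have [kn|kn] := leqP k n.+2; last first.
    case: k kn => // k kn.
    have := uC n.+1 k.+1; have := uC n.+1 k; rewrite !bin_small; by [case: c; lia|lia].
  have [ma mb] := env_mono env (ltn0Sn n) (ltnSn n.+1).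
  rewrite subSnn expr1 in ma; rewrite subSnn expr1 in mb.
  move/XY_bern_le : ma => /(_ k kn); move/bern_le_XY : mb => /(_ k kn).
  have -> : pascal (fun k => 'C(n.+1, k)%:R * b n.+1 k) k =
     'C(n.+2, k)%:R - pascal (fun k => (u false n.+1 k)%:R) k.
    rewrite -pascal_bin /pascal (uE n.+1 k isT).2.
    by case: (k) => [|j]; rewrite ?(uE n.+1 j isT).2; ring.
  rewrite (uE n.+2 k isT).2 lerD2l lerN2 (uE n.+2 k isT).1 => le_f le_t.
  rewrite -(ler_nat R) natrD; case: c.
    move: le_t; rewrite /pascal (uE n.+1 k isT).1.
    by case: (k) => [|j]; rewrite ?(uE n.+1 j isT).1.
  by move: le_f; rewrite /pascal; case: (k).
have [l gl lu] := labelling_exists uC uS.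
by exists l => // n n0 k _; rewrite /nlabelled !lu; exact: uE.
Qed.

(** * From algorithms to labellings *)

(** Locality of the event N <= m gives N <= m for the second sequence, by some
    value m'; locality of N <= m' for that value then forces equality. *)
Lemma inputs_local A w v m :
  inputs A w = Some m -> hist w m = hist v m -> inputs A v = Some m.
Proof.
move=> wm wv.
have [m' vm' m'm] : exists2 m', inputs A v = Some m' & (m' <= m)%N.
  by have := natural_filtration_local (@inputs_stopping A m) wv; apply; exists m.
have [m'' wm'' m''m'] : exists2 m'', inputs A w = Some m'' & (m'' <= m')%N.
  have := natural_filtration_local (@inputs_stopping A m') (hist_widen m'm (esym wv)).
  by apply; exists m'.
move: wm''; rewrite wm => -[mm'']; rewrite vm'; congr Some; lia.
Qed.

(** [word s] stands for an arbitrary continuation of [s]: by [inputs_local],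
    whether [A] stops within [size s] tosses does not depend on it. *)
Definition label (A : algorithm) (s : seq bool) : option bool :=
  if inputs A (word s) is Some m then
    if (m <= size s)%N then Some (rule A (rev (hist (word s) m))) else None
  else None.

Lemma label_hist A w n b : label A (hist w n) = Some b <->
  exists m, [/\ inputs A w = Some m, (m <= n)%N & rule A (rev (hist w m)) = b].
Proof.
have hh : hist (word (hist w n)) n = hist w n.
  by rewrite -{2}(size_hist w n) hist_word.
rewrite /label size_hist; split=> [|[m [wm mn rb]]].
  case wm : (inputs A _) => [m|//]; case: leqP => // mn [rb].
  have h := hist_widen mn hh; exists m; split=> //; last by rewrite -h.
  exact: inputs_local wm h.
have h := hist_widen mn hh.
by rewrite (inputs_local wm (esym h)) mn h rb.
Qed.

Lemma label_growing A : growing (label A).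
Proof.
move=> c s b; set w := word (c :: s).
have ws : hist w (size s).+1 = c :: s by exact: (hist_word (c :: s)).
have sE : s = hist w (size s) by case: ws.
rewrite {1}sE -ws => /label_hist[m [wm ms rb]].
by apply/label_hist; exists m; split=> //; exact: leqW.
Qed.

Lemma verdict_label A b :
  verdict (label A) b = [set w | output A w = Some b].
Proof.
apply/seteqP; split => w; rewrite /verdict /output /=.
  by move=> [n] /label_hist[m [-> _ <-]]; rewrite -rev_hist.
case wm : (inputs A w) => [m|//] [rb]; exists m; apply/label_hist.
by exists m; split=> //; rewrite rev_hist.
Qed.

Lemma inputs_finite A :
  [set w | inputs A w != None] =
  verdict (label A) true `|` verdict (label A) false.
Proof.
rewrite !verdict_label; apply/seteqP; split => w; rewrite /output /=.
  by case: (inputs A w) => // m _; case: (rule _ _); [left|right].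
by case: (inputs A w) => // -[].
Qed.

Lemma coin_law_inputs_finite (R : realType) (p : R) A :
  coin_law p [set w | inputs A w != None] =
  (coin_law p (verdict (label A) true) +
   coin_law p (verdict (label A) false))%E.
Proof.
have gA : growing (label A) := @label_growing A.
rewrite inputs_finite measureU //.
- exact: measurable_verdict.
- exact: measurable_verdict.
- exact: verdict_disjoint.
Qed.

(** * From labellings to algorithms *)

Definition stop (l : seq bool -> option bool) (w : tosses) : option nat :=
  if pselect (exists n, l (hist w n)) is left h then Some (ex_minn h) else None.

Lemma stop_le l w n : growing l ->
  (exists2 m, stop l w = Some m & (m <= n)%N) <-> l (hist w n).
Proof.
move=> gl; rewrite /stop; case: pselect => [h|h]; last first.
  by split=> [[]//|ln]; case: h; exists n.
case: ex_minnP => m lm mP; split=> [[_ [<-] mn]|/mP mn]; last by exists m.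
by case lmE : (l (hist w m)) lm => [b|//] _; rewrite (growing_hist gl mn lmE).
Qed.

Lemma stop_stopping l n : growing l ->
  natural_filtration n [set w | exists2 m, stop l w = Some m & (m <= n)%N].
Proof.
move=> gl; rewrite (_ : [set _ | _] = [set w | l (hist w n)]).
  exact: (@natural_filtration_hist n (fun s => l s)).
by apply/seteqP; split => w /(stop_le w n gl).
Qed.

Definition algorithm_of l (gl : growing l) : algorithm :=
  Algorithm (fun n => @stop_stopping l n gl) (fun s => l (rev s) == Some true).

Lemma verdict_algorithm_of l (gl : growing l) b :
  verdict (label (algorithm_of gl)) b = verdict l b.
Proof.
rewrite verdict_label; apply/seteqP; split => w; rewrite /output /=.
  case wm : (stop l w) => [m|//] [].
  have : l (hist w m) by apply/(stop_le w m gl); exists m.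
  rewrite -rev_hist revK; case lm : (l (hist w m)) => [c|//] _ <-.
  by exists m; rewrite lm; case: c {lm}.
move=> [n ln]; have [|m wm mn] := (stop_le w n gl).2; first by rewrite ln.
have : l (hist w m) by apply/(stop_le w m gl); exists m.
rewrite wm -rev_hist revK; case lm : (l (hist w m)) => [c|//] _.
by move: (growing_hist gl mn lm); rewrite ln => -[->]; case: (c).
Qed.

(** * Algorithms and envelopes *)

Theorem proposition3 (R : realType) (S : set R) (f : R -> R)
    (S01 : S `<=` `]0, 1[) (f01 : forall p, S p -> 0 <= f p <= 1) :
  ((exists A : algorithm, simulates A S f) ->
     exists a b : nat -> nat -> R, envelopes S f a b) /\
  (forall a b : nat -> nat -> R, envelopes S f a b ->
     exists2 A : algorithm, simulates A S f &
       forall p n, S p -> (1 <= n)%N ->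
         coin_law p (inputs_gt A n) =
         ((bern n (b n)).[p, 1 - p] - (bern n (a n)).[p, 1 - p])%:E).
Proof.
split=> [[A sA]|a b env].
  exists (fun n k => (nlabelled (label A) true n k)%:R / 'C(n, k)%:R).
  exists (fun n k => 1 - (nlabelled (label A) false n k)%:R / 'C(n, k)%:R).
  apply: envelopes_labelling => // [|p Sp]; first exact: label_growing.
  have [fin ft] := sA p Sp; rewrite -verdict_label in ft; split=> //.
  have vfin : coin_law p (verdict (label A) false) \is a fin_num.
    by apply: fin_num_measure; exact: measurable_verdict.
  (* A stops almost surely, so output 0 has the complementary probability. *)
  move: fin; rewrite coin_law_inputs_finite ft -(fineK vfin) => -[<-].
  by congr EFin; rewrite addrC addrK.
have [l gl enc] := labelling_envelopes env.
exists (algorithm_of gl) => [p Sp|p n Sp n0];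
  have p01 : 0 <= p <= 1 by
    have := S01 p Sp; rewrite /= in_itv /= => /andP[/ltW -> /ltW ->].
  have [ct cf] := env_cvg env Sp.
  rewrite -[f p](subKr 1) in cf.
  have [lt lf] := (cvg_encodes p (f p) (1 - f p) enc).1 (conj ct cf).
  have vE c : coin_law p (verdict l c) = (if c then f p else 1 - f p)%:E.
    have vfin : coin_law p (verdict l c) \is a fin_num.
      by apply: fin_num_measure; exact: measurable_verdict.
    rewrite -(fineK vfin); congr EFin.
    apply: (cvg_unique _ (@cvg_verdict _ gl _ _ c p01)) => //.
    by case: c {vfin}.
  rewrite coin_law_inputs_finite -verdict_label !verdict_algorithm_of !vE.
  by split=> //; rewrite -EFinD addrC subrK.
have [-> ->] := horner_encodes p (enc n n0).
rewrite (_ : inputs_gt _ n = [set w | l (hist w n) == None]).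
  have -> := coin_law_hist p01 n (fun s => l s == None).
  (* Coefficientwise: unlabelled = all - labelled 0 - labelled 1. *)
  congr EFin; rewrite -[X in X - _ - _](eval_form_bin p n) /eval_form -!sumrB.
  apply: eq_bigr => k _; rewrite -(nstrings_None l n k) !natrD; ring.
apply/seteqP; split => w; rewrite /inputs_gt /=.
  case wm : (stop l w) => [m|] nm.
    case lw : (l (hist w n)) => [c|//].
    have [|m' + m'n] := (stop_le w n gl).2; first by rewrite lw.
    by rewrite wm => -[mm']; move: nm; rewrite mm' ltnNge m'n.
  case lw : (l (hist w n)) => [c|//].
  have [|m' + _] := (stop_le w n gl).2; first by rewrite lw.
  by rewrite wm.
move=> /eqP lw; case wm : (stop l w) => [m|//]; rewrite ltnNge.
by apply/negP => mn; have : l (hist w n); [apply/(stop_le w n gl); exists m|rewrite lw].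
Qed.
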